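(* For all positive integers $m$ and $n$, $$s(m)=\min\{n' : g(n')\ge m\}\qquad\text{and}\qquad g(n)=\max\{m' : s(m')\le n\},$$ where $n'$ and $m'$ range over the positive integers.
   Context: All graphs are finite, simple and undirected. A set $I$ of vertices of a graph $G$ is independent if there is no edge between any two vertices of $I$; it is a maximal independent set (MIS) if it is not properly contained in any other independent set of $G$. For a positive integer $n$, define $g(n)=\max\{m : \text{there is a graph on } n \text{ vertices with exactly } m \text{ MISes}\}$. A separating cover over a ground set $X$ is a collection $\mathcal{S}$ of subsets of $X$ such that (i) the union of the sets in $\mathcal{S}$ is all of $X$, and (ii) for every pair of distinct elements $x,y\in X$ there are disjoint sets $S,T\in\mathcal{S}$ with $x\in S$ and $y\in T$. A separating cover on $m$ elements with $n$ sets is a separating cover $\mathcal{S}$ over a ground set $X$ with $|X|=m$ and $|\mathcal{S}|=n$. For a positive integer $m$, define $s(m)=\min\{n : \text{there is a separating cover on } m \text{ elements with } n \text{ sets}\}$. *)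

(* Defs.v *)
From mathcomp Require Import all_boot.

Set Implicit Arguments.
Unset Strict Implicit.
Unset Printing Implicit Defensive.

Definition is_min (P : nat -> Prop) (k : nat) : Prop :=
  P k /\ forall j, P j -> k <= j.

Definition is_max (P : nat -> Prop) (k : nat) : Prop :=
  P k /\ forall j, P j -> j <= k.

(* A finite simple undirected graph with vertex type T is given by its edge   *)
(* set E, a set of two-element subsets of T.                                  *)
Definition simple_graph (T : finType) (E : {set {set T}}) : bool :=
  [forall e in E, #|e| == 2].

Definition independent (T : finType) (E : {set {set T}}) (I : {set T}) : bool :=
  [forall x in I, forall y in I, [set x; y] \notin E].

Definition MIS (T : finType) (E : {set {set T}}) : {set {set T}} :=
  [set I | maxset (independent E) I].

Definition separating_cover (T : finType) (S : {set {set T}}) : bool :=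
  (cover S == [set: T]) &&
  [forall x, forall y, (x != y) ==>
     [exists A in S, exists B in S, [&& [disjoint A & B], x \in A & y \in B]]].

(* The vertex set, resp. the ground set, is taken to be 'I_n, resp. 'I_m;     *)
(* gP and sP below show that this loses no generality.                        *)
Definition g (n : nat) : nat :=
  \max_(E : {set {set 'I_n}} | simple_graph E) #|MIS E|.

Lemma separating_cover_set1 (T : finType) :
  separating_cover [set [set x] | x : T].
Proof.
apply/andP; split.
  apply/eqP/setP=> x; rewrite inE; apply/bigcupP.
  by exists [set x]; rewrite ?set11 // imset_f.
apply/forallP=> x; apply/forallP=> y; apply/implyP=> xy.
apply/existsP; exists [set x]; rewrite imset_f //=.
apply/existsP; exists [set y]; rewrite imset_f //= !set11 !andbT.
by rewrite disjoints1 inE.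
Qed.

Lemma separating_cover_exists (m : nat) :
  exists n, [exists S : {set {set 'I_m}}, separating_cover S && (#|S| == n)].
Proof.
exists #|[set [set x] | x : 'I_m]|; apply/existsP.
by exists [set [set x] | x : 'I_m]; rewrite separating_cover_set1 eqxx.
Qed.

Definition s (m : nat) : nat := ex_minn (separating_cover_exists m).

Section Transport.
Variables (T U : finType) (f : T -> U) (f' : U -> T).
Hypotheses (fK : cancel f f') (f'K : cancel f' f).

Let F (A : {set T}) : {set U} := f @: A.
Let F' (B : {set U}) : {set T} := f' @: B.

Let f_inj : injective f. Proof. exact: can_inj fK. Qed.

Let FK : cancel F F'.
Proof.
move=> A; rewrite /F /F' -imset_comp -[RHS]imset_id.
by apply: eq_imset => x; apply: fK.
Qed.

Let F'K : cancel F' F.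
Proof.
move=> A; rewrite /F /F' -imset_comp -[RHS]imset_id.
by apply: eq_imset => x; apply: f'K.
Qed.

Let F_inj : injective F. Proof. exact: can_inj FK. Qed.

Lemma simple_graph_imset (E : {set {set T}}) :
  simple_graph E -> simple_graph (F @: E).
Proof.
move=> /forall_inP gE; apply/forall_inP => _ /imsetP[e eE ->].
by rewrite card_imset // gE.
Qed.

Lemma independent_imset (E : {set {set T}}) (A : {set T}) :
  independent (F @: E) (F A) = independent E A.
Proof.
have eE x y : ([set f x; f y] \in F @: E) = ([set x; y] \in E).
  have -> : [set f x; f y] = F [set x; y] by rewrite /F imsetU1 imset_set1.
  by rewrite mem_imset.
apply/forall_inP/forall_inP => H x xA; apply/forall_inP => y yA.
  rewrite -eE; move: (H (f x)); rewrite mem_imset // => /(_ xA) /forall_inP.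
  by apply; rewrite mem_imset.
case/imsetP: xA => x0 x0A ->; case/imsetP: yA => y0 y0A ->.
by rewrite eE; move: (H x0 x0A) => /forall_inP; apply.
Qed.

Lemma card_MIS_imset (E : {set {set T}}) : #|MIS (F @: E)| = #|MIS E|.
Proof.
rewrite -(card_imset (mem (MIS E)) F_inj); apply: eq_card => B.
rewrite -(F'K B) mem_imset // !inE; move: (F' B) => A.
apply/maxsetP/maxsetP; rewrite independent_imset => -[iA maxA].
  split=> // A' iA' sAA'; apply: F_inj; apply: maxA.
    by rewrite independent_imset.
  exact: imsetS.
split=> // B'; rewrite -(F'K B') independent_imset => iB' sAB'.
by congr F; apply: maxA => //; rewrite -(FK A) -(FK (F' B')) imsetS.
Qed.

Lemma separating_cover_imset (S : {set {set T}}) :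
  separating_cover S -> separating_cover (F @: S).
Proof.
case/andP=> /eqP cS /forallP sS; apply/andP; split.
  apply/eqP/setP=> y; rewrite inE; apply/bigcupP.
  have /bigcupP[A AS yA] : f' y \in cover S by rewrite cS.
  by exists (F A); [rewrite imset_f | rewrite -[y]f'K imset_f].
apply/forallP=> x; apply/forallP=> y; apply/implyP=> xy.
have /implyP := forallP (sS (f' x)) (f' y).
rewrite (can_eq f'K) => /(_ xy).
case/exists_inP=> A AS /exists_inP[B BS /and3P[dAB xA yB]].
apply/exists_inP; exists (F A); rewrite ?imset_f //.
apply/exists_inP; exists (F B); rewrite ?imset_f //.
rewrite (imset_disjoint f_inj) dAB /=.
by rewrite -{1}[x]f'K -{1}[y]f'K; apply/andP; split; apply: imset_f.
Qed.

Lemma card_imset2 (S : {set {set T}}) : #|F @: S| = #|S|.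
Proof. exact: card_imset. Qed.

End Transport.

Lemma gP (n : nat) :
  is_max (fun m => exists (T : finType) (E : {set {set T}}),
            [/\ #|T| = n, simple_graph E & #|MIS E| = m]) (g n).
Proof.
split.
  have g0 : simple_graph (set0 : {set {set 'I_n}}).
    by apply/forall_inP => e; rewrite inE.
  have gpos : 0 < #|@simple_graph 'I_n| by apply/card_gt0P; exists set0.
  have [E gE gn] := eq_bigmax_cond (fun E => #|MIS E|) gpos.
  by exists 'I_n, E; rewrite card_ord /g gn.
move=> _ [T [E [<- gE <-]]].
rewrite -(card_MIS_imset (@enum_rankK T) (@enum_valK T)).
apply: (leq_bigmax_cond (F := fun E => #|MIS E|)).
exact: (simple_graph_imset (@enum_rankK T)).
Qed.

Lemma sP (m : nat) :
  is_min (fun n => exists (T : finType) (S : {set {set T}}),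
            [/\ #|T| = m, separating_cover S & #|S| = n]) (s m).
Proof.
rewrite /s; case: ex_minnP => n /existsP[S /andP[cS /eqP Sn]] minn.
split; first by exists 'I_m, S; rewrite card_ord.
move=> _ [T [S' [Tm cS' <-]]]; case: m / Tm S cS Sn minn => S cS Sn minn.
apply: minn; apply/existsP; exists [set enum_rank @: (A : {set T}) | A in S'].
rewrite (separating_cover_imset (@enum_rankK T) (@enum_valK T)) //=.
by rewrite (card_imset2 (@enum_rankK T)).
Qed.

(* Main.v *)
(* In the graph on the sets of a separating cover with disjoint sets joined,  *)
(* the sets containing a given element are independent, hence extend to a     *)
(* MIS, and separation makes these MISes pairwise distinct. Conversely, over  *)
(* any family of MISes of a graph, the vertices v give a separating cover by  *)
(* the sets {I : v \in I}: two distinct MISes I and J are joined by an edge   *)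
(* uv with u in I and v in J, and no MIS contains both u and v.               *)
Require Import Defs.
From mathcomp Require Import all_boot.

(** For [n > 0], [s m <= n] holds exactly when [m <= g n], so each of [s] and [g] is read off from
    the other as a least or greatest solution. Passing from covers to graphs gives [leq_g_of_s], via
    [leq_g_of_separating]; passing from graphs to covers gives [s_leq_of_g], via [s_leq_of_MIS]. *)

Lemma independentP (T : finType) (E : {set {set T}}) (I : {set T}) :
  reflect {in I &, forall x y, [set x; y] \notin E} (independent E I).
Proof.
apply: (iffP forall_inP) => H x; last by move=> xI; apply/forall_inP=> y; exact: H.
by move=> y xI yI; exact: (forall_inP (H x xI)).
Qed.

Lemma MIS_P (T : finType) (E : {set {set T}}) (I : {set T}) :
  reflect (independent E I /\ forall J, independent E J -> I \subset J -> J = I)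
          (I \in MIS E).
Proof. by rewrite inE; apply: maxsetP. Qed.

Lemma simple_graph_set1 (T : finType) (E : {set {set T}}) (x : T) :
  simple_graph E -> [set x] \notin E.
Proof. by move=> /forall_inP gE; apply/negP=> /gE; rewrite cards1. Qed.

(** With no loops, a singleton is independent and would extend the empty set. This supplies the
    covering condition in [s_leq_of_MIS]. *)
Lemma MIS_neq0 (T : finType) (E : {set {set T}}) (I : {set T}) :
  simple_graph E -> 0 < #|T| -> I \in MIS E -> I != set0.
Proof.
move=> gE /card_gt0P[v _] /MIS_P[_ maxI]; apply/eqP=> I0.
have : [set v] = I.
  apply: maxI; last by rewrite I0 sub0set.
  apply/independentP=> x y /set1P-> /set1P->.
  by rewrite setUid simple_graph_set1.
by rewrite I0 => /setP/(_ v); rewrite !inE eqxx.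
Qed.

(** Without such an edge [I :|: J] would be independent, and maximality would make both sets equal
    to it. *)
Lemma MIS_edge (T : finType) (E : {set {set T}}) (I J : {set T}) :
  I \in MIS E -> J \in MIS E -> I != J ->
  exists u v, [/\ u \in I, v \in J & [set u; v] \in E].
Proof.
move=> /MIS_P[iI maxI] /MIS_P[iJ maxJ] /eqP neqIJ.
have [/exists_inP[u uI /exists_inP[v vJ uvE]]|noE] :=
  boolP [exists u in I, exists v in J, [set u; v] \in E].
  by exists u, v.
have noIJ u v : u \in I -> v \in J -> [set u; v] \notin E.
  move=> uI vJ; apply: contra noE => uvE.
  by apply/exists_inP; exists u => //; apply/exists_inP; exists v.
have iIJ : independent E (I :|: J).
  apply/independentP=> x y /setUP[] xI /setUP[] yI.
  - exact: (independentP _ _ _ iI).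
  - exact: noIJ.
  - by rewrite setUC noIJ.
  - exact: (independentP _ _ _ iJ).
case: neqIJ; rewrite -(maxI _ iIJ (subsetUl _ _)).
exact: maxJ iIJ (subsetUr _ _).
Qed.

(* The family is indexed, so that it may repeat sets or be padded with set0:  *)
(* this yields graphs with more vertices than the cover has sets.             *)
Lemma leq_g_of_separating (T X : finType) (F : T -> {set X}) :
    (forall x y, x != y ->
       exists i j, [/\ [disjoint F i & F j], x \in F i & y \in F j]) ->
  #|X| <= g #|T|.
Proof.
move=> sepF.
(* An empty [F i] is disjoint from itself, so loops have to be excluded explicitly. *)
pose disj_edge i j := (i != j) && [disjoint F i & F j].
pose E := [set [set p.1; p.2] | p : T * T & disj_edge p.1 p.2].
have gE : simple_graph E.
  apply/forall_inP=> _ /imsetP[[i j] + ->].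
  by rewrite inE cards2 /= => /andP[-> _].
have iE x : independent E [set i | x \in F i].
  apply/independentP=> i j; rewrite !inE => xi xj.
  apply/negP=> /imsetP[[k l]]; rewrite inE /= => /andP[_ dkl] eq_ijkl.
  have xF h : h \in [set k; l] -> x \in F h.
    by rewrite -eq_ijkl => /set2P[] ->.
  by move: (disjointFr dkl (xF k (set21 _ _))); rewrite (xF l (set22 _ _)).
have extend x : {I | maxset (independent E) I & [set i | x \in F i] \subset I}.
  exact: maxset_exists.
pose mis x := s2val (extend x).
have mis_max x : maxset (independent E) (mis x) by rewrite /mis; case: (extend x).
have in_mis x i : x \in F i -> i \in mis x.
  by move=> xi; have /subsetP := s2valP' (extend x); apply; rewrite inE.
have mis_inj : injective mis.
  move=> x y eq_mis; apply/eqP/negPn/negP=> /sepF[i [j [dij xi yj]]].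
  have neq_ij : i != j.
    by apply/eqP=> eq_ij; move: (disjointFr dij xi); rewrite -eq_ij xi.
  have /MIS_P[/independentP ind_x _] : mis x \in MIS E by rewrite inE.
  have j_mis : j \in mis x by rewrite eq_mis in_mis.
  have /negP := ind_x i j (in_mis x i xi) j_mis; apply.
  by apply/imsetP; exists (i, j); rewrite ?inE /disj_edge ?neq_ij.
have [_ maxg] := gP #|T|.
apply: leq_trans (maxg _ (ex_intro _ T (ex_intro _ E (And3 erefl gE erefl)))).
rewrite -(card_codom mis_inj); apply/subset_leq_card/subsetP=> _ /codomP[x ->].
by rewrite inE.
Qed.

Lemma leq_g_of_s (m n : nat) : s m <= n -> m <= g n.
Proof.
have [[X [S [<- /andP[_ /forallP sepS] <-]]] _] := sP m => le_Sn.
rewrite -(card_ord n).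
apply: (@leq_g_of_separating _ _ (fun i : 'I_n => nth set0 (enum S) i)).
have index_lt A : A \in S -> index A (enum S) < n.
  by move=> AS; apply: leq_trans le_Sn; rewrite cardE index_mem mem_enum.
move=> x y xy; have /implyP/(_ xy) := forallP (sepS x) y.
case/exists_inP=> A AS /exists_inP[B BS /and3P[dAB xA yB]].
exists (Ordinal (index_lt A AS)), (Ordinal (index_lt B BS)).
by rewrite /= !nth_index ?mem_enum.
Qed.

Lemma s_leq_of_MIS (T : finType) (E : {set {set T}}) (m : nat) :
  simple_graph E -> 0 < #|T| -> m <= #|MIS E| -> s m <= #|T|.
Proof.
move=> gE T_gt0 le_m.
pose mis (k : 'I_m) := enum_val (widen_ord le_m k).
have misP k : mis k \in MIS E by apply: enum_valP.
have mis_inj : injective mis.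
  by move=> k l /enum_val_inj/(congr1 val)/= /val_inj.
pose S := [set [set k | v \in mis k] | v : T].
have sepS : separating_cover S.
  apply/andP; split.
    apply/eqP/setP=> k; rewrite inE; apply/bigcupP.
    have /set0Pn[v vk] := MIS_neq0 _ _ _ gE T_gt0 (misP k).
    by exists [set k | v \in mis k]; rewrite ?imset_f ?inE.
  apply/forallP=> k; apply/forallP=> l; apply/implyP=> neq_kl.
  have [|u [v [uk vl uvE]]] := MIS_edge _ _ _ _ (misP k) (misP l).
    by rewrite (inj_eq mis_inj).
  apply/exists_inP; exists [set h | u \in mis h]; first exact: imset_f.
  apply/exists_inP; exists [set h | v \in mis h]; first exact: imset_f.
  rewrite !inE uk vl !andbT; apply/pred0Pn=> -[h /=]; rewrite !inE => /andP[uh vh].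
  have /MIS_P[/independentP ind_h _] := misP h.
  by have /negP := ind_h u v uh vh.
have [_ mins] := sP m.
(* Different vertices may lie in the same chosen MISes, so [S] may have fewer than [#|T|] sets. *)
apply: leq_trans (leq_imset_card (fun v => [set k | v \in mis k]) T).
by apply: mins; exists 'I_m, S; rewrite card_ord.
Qed.

(** Positivity of [n] matters: the graph without vertices has the empty set as its one MIS, so
    [g 0 = 1], while [s 1 = 1]. *)
Lemma s_leq_of_g (m n : nat) : 0 < n -> m <= g n -> s m <= n.
Proof.
have [[T [E [<- gE <-]]] _] := gP n.
exact: s_leq_of_MIS.
Qed.

Lemma s_gt0 (m : nat) : 0 < m -> 0 < s m.
Proof.
have [[X [S [<- /andP[/eqP covS _] <-]]] _] := sP m => /card_gt0P[x _].
have /bigcupP[A AS _] : x \in cover S by rewrite covS.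
by apply/card_gt0P; exists A.
Qed.

Theorem proposition7 (m n : nat) (hm : 0 < m) (hn : 0 < n) :
  is_min (fun n' => 0 < n' /\ m <= g n') (s m) /\
  is_max (fun m' => 0 < m' /\ s m' <= n) (g n).
Proof.
split; split.
- by split; [exact: s_gt0 | exact: leq_g_of_s].
- by move=> j [j_gt0]; exact: s_leq_of_g.
- split; last exact: s_leq_of_g.
  (* One set covers a single element; this yields [0 < g n]. *)
  have s1 : s 1 <= n.
    have [_ mins] := sP 1; apply: leq_trans hn; apply: mins.
    exists 'I_1, [set [set x] | x : 'I_1].
    by rewrite card_ord separating_cover_set1 (card_imset _ set1_inj) card_ord.
  exact: leq_g_of_s s1.
- by move=> j [_]; exact: leq_g_of_s.
Qed.
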